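(* For every $n\in\omega$, no principle $\mathsf P$ having an $\omega$-model all of whose members are low${}_2$ over $\emptyset^{(n)}$, and such that $\mathsf{STS}(n+2)\leq_c \mathsf P$, admits a universal instance.
   Context: A principle has instances and solutions; a degree bounds $\mathsf P$ if every computable instance has a solution computable in it; a universal instance is a computable instance all of whose solutions bound $\mathsf P$. $\mathsf{P} \leq_c \mathsf{Q}$ if every instance $X$ of $\mathsf P$ computes an instance $Y$ of $\mathsf Q$ such that every solution to $Y$ computes, relative to $X$, a solution to $X$. An $\omega$-model of $\mathsf P$ is a nonempty collection of sets closed under $\oplus$ and $\leq_T$ in which every instance of $\mathsf P$ has a solution. $X$ is low${}_2$ over $Y$ if $(X\oplus Y)''\leq_T Y''$. For $k \geq 1$, $g:[\omega]^{k+1}\to\omega$ is stable if $\lim_s g(\sigma,s)$ exists for each $\sigma\in[\omega]^k$; $A$ is thin for $g:[\omega]^k \to \omega$ if $g([A]^k)\neq\omega$; $\mathsf{STS}(k)$: every stable $g:[\omega]^k\to\omega$ has an infinite thin set. *)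

(* Defs.v *)
From HB Require Import structures.
From mathcomp Require Import all_boot.
Set Implicit Arguments. Unset Strict Implicit. Unset Printing Implicit Defensive.

Definition set_nat := nat -> Prop.

(* Cantor pairing (a bijection nat * nat -> nat). *)
Definition cpair (a b : nat) : nat := ((a + b) * (a + b).+1) %/ 2 + b.

(* Coding of finite sequences (a bijection seq nat -> nat). *)
Fixpoint code_seq (s : seq nat) : nat :=
  if s is x :: s' then (cpair x (code_seq s')).+1 else 0.

Definition join (X Y : set_nat) : set_nat :=
  fun x => (exists k, x = k.*2 /\ X k) \/ (exists k, x = k.*2.+1 /\ Y k).

Inductive prog : Type :=
| PZero | PSucc | PId | PFst | PSnd | POrac
| PComp (f g : prog)
| PPair (f g : prog)
| PRec (f g : prog)
| PMu (f : prog).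

Inductive eval (A : set_nat) : prog -> nat -> nat -> Prop :=
| eZero x : eval A PZero x 0
| eSucc x : eval A PSucc x x.+1
| eId x : eval A PId x x
| eFst a b : eval A PFst (cpair a b) a
| eSnd a b : eval A PSnd (cpair a b) b
| eOrac1 x : A x -> eval A POrac x 1
| eOrac0 x : ~ A x -> eval A POrac x 0
| eComp f g x y z : eval A g x y -> eval A f y z -> eval A (PComp f g) x z
| ePair f g x y z : eval A f x y -> eval A g x z -> eval A (PPair f g) x (cpair y z)
| eRec0 f g x y : eval A f x y -> eval A (PRec f g) (cpair x 0) y
| eRecS f g x n y z : eval A (PRec f g) (cpair x n) y ->
    eval A g (cpair (cpair x n) y) z -> eval A (PRec f g) (cpair x n.+1) z
| eMu f x n : eval A f (cpair x n) 0 ->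
    (forall m, m < n -> exists2 k, k <> 0 & eval A f (cpair x m) k) ->
    eval A (PMu f) x n.

Definition turing_le (X A : set_nat) : Prop :=
  exists p : prog, forall x, (X x -> eval A p x 1) /\ (~ X x -> eval A p x 0).

Definition empty_set : set_nat := fun _ => False.
Definition computable (X : set_nat) : Prop := turing_le X empty_set.

Fixpoint prog_to_tree (p : prog) : GenTree.tree unit :=
  match p with
  | PZero => GenTree.Node 0 [::]
  | PSucc => GenTree.Node 1 [::]
  | PId => GenTree.Node 2 [::]
  | PFst => GenTree.Node 3 [::]
  | PSnd => GenTree.Node 4 [::]
  | POrac => GenTree.Node 5 [::]
  | PComp f g => GenTree.Node 6 [:: prog_to_tree f; prog_to_tree g]
  | PPair f g => GenTree.Node 7 [:: prog_to_tree f; prog_to_tree g]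
  | PRec f g => GenTree.Node 8 [:: prog_to_tree f; prog_to_tree g]
  | PMu f => GenTree.Node 9 [:: prog_to_tree f]
  end.

Fixpoint tree_to_prog (t : GenTree.tree unit) : option prog :=
  match t with
  | GenTree.Node 0 [::] => Some PZero
  | GenTree.Node 1 [::] => Some PSucc
  | GenTree.Node 2 [::] => Some PId
  | GenTree.Node 3 [::] => Some PFst
  | GenTree.Node 4 [::] => Some PSnd
  | GenTree.Node 5 [::] => Some POrac
  | GenTree.Node 6 [:: f; g] =>
      match tree_to_prog f, tree_to_prog g with
      | Some f', Some g' => Some (PComp f' g') | _, _ => None end
  | GenTree.Node 7 [:: f; g] =>
      match tree_to_prog f, tree_to_prog g with
      | Some f', Some g' => Some (PPair f' g') | _, _ => None end
  | GenTree.Node 8 [:: f; g] =>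
      match tree_to_prog f, tree_to_prog g with
      | Some f', Some g' => Some (PRec f' g') | _, _ => None end
  | GenTree.Node 9 [:: f] =>
      match tree_to_prog f with Some f' => Some (PMu f') | None => None end
  | _ => None
  end.

Lemma prog_treeK : pcancel prog_to_tree tree_to_prog.
Proof. by elim=> //= f -> // g ->. Qed.

Definition decode_prog (e : nat) : option prog :=
  obind tree_to_prog (unpickle e).

Definition jump (A : set_nat) : set_nat :=
  fun e => exists2 p, decode_prog e = Some p & exists y, eval A p e y.

Definition jumpn (n : nat) (A : set_nat) : set_nat := iter n jump A.
Definition zero_jump (n : nat) : set_nat := jumpn n empty_set.

Definition low2_over (X Y : set_nat) : Prop :=
  turing_le (jump (jump (join X Y))) (jump (jump Y)).

Record principle := Principle {
  inst : set_nat -> Prop;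
  sol : set_nat -> set_nat -> Prop   (* sol X S : S is a solution to X *)
}.

Definition bounds (P : principle) (D : set_nat) : Prop :=
  forall X, computable X -> inst P X -> exists2 S, sol P X S & turing_le S D.

Definition universal_instance (P : principle) (X : set_nat) : Prop :=
  [/\ computable X, inst P X & forall S, sol P X S -> bounds P S].

Definition has_universal_instance (P : principle) : Prop :=
  exists X, universal_instance P X.

Definition c_reducible (P Q : principle) : Prop :=
  forall X, inst P X -> exists2 Y, turing_le Y X /\ inst Q Y &
    forall T, sol Q Y T -> exists2 S, sol P X S & turing_le S (join T X).

Definition omega_model (P : principle) (M : set_nat -> Prop) : Prop :=
  [/\ exists X, M X,
      (forall X Y, M X -> M Y -> M (join X Y)),
      (forall X Y, M Y -> turing_le X Y -> M X) &
      (forall X, M X -> inst P X -> exists2 S, M S & sol P X S)].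

Definition finsub (k : nat) (s : seq nat) : bool := (size s == k) && sorted ltn s.
Definition finsub_of (A : set_nat) (k : nat) (s : seq nat) : Prop :=
  finsub k s /\ forall x, x \in s -> A x.

Definition codes_fn (k : nat) (g : seq nat -> nat) (X : set_nat) : Prop :=
  forall m, X m <-> exists2 s, finsub k s & m = cpair (code_seq s) (g s).

Definition stable (m : nat) (g : seq nat -> nat) : Prop :=
  forall sigma, finsub m sigma ->
    exists v, exists N, forall s, N <= s -> finsub m.+1 (rcons sigma s) ->
      g (rcons sigma s) = v.

Definition infinite (A : set_nat) : Prop := forall N, exists2 x, N <= x & A x.

Definition thin (k : nat) (g : seq nat -> nat) (A : set_nat) : Prop :=
  exists v, forall s, finsub_of A k s -> g s <> v.

(* STS(k), intended for k >= 2 (stability of g on [omega]^k refers to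
   limits over the last coordinate, sigma ranging over [omega]^(k-1)). *)
Definition STS (k : nat) : principle :=
  {| inst := fun X => exists g, codes_fn k g X /\ stable k.-1 g;
     sol := fun X A => exists g, [/\ codes_fn k g X, infinite A & thin k g A] |}.

(* Main.v *)
Require Import Defs.
From mathcomp Require Import all_boot.
From mathcomp Require Import zify.
From Stdlib Require Import Classical ClassicalEpsilon.
Set Implicit Arguments. Unset Strict Implicit. Unset Printing Implicit Defensive.

(* A universal instance would have a solution S in the omega-model, so S is low2 over Z = 0^(n) and
   computes solutions to all computable instances of P, hence infinite thin sets for all computable
   stable g : [omega]^(n+2) -> omega. This is refuted by a 0^(n+1)-computable f : omega -> omega taking
   every value on every infinite S-c.e. set: by the limit lemma f is an (n+1)-fold iterated limit of a
   computable g, and a set thin for g that omits v would yield an infinite set on which f omits v.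

   To get f, list the requirements R_i, i = (c, v): "if the S-c.e. set W_c is infinite, then f = v
   somewhere on W_c". If f has index j as a Z'-computable function, whether R_i is met is Sigma_1 in
   (S + Z)', uniformly in i and j, hence decidable in (S + Z)'' <=_T Z'', hence has a Z'-computable
   approximation. Put f(s) = v for the least i = (c, v) <= s that looks unmet at stage s, where j is an
   index of f itself. A least unmet R_i would eventually force f(s) = v for all large s and so be met. *)

(** * Pairing and computable functions *)

Lemma cpair_next a b : cpair a b.+1 = (cpair a.+1 b).+1.
Proof. by rewrite /cpair addSnnS [in LHS]addnS. Qed.

Lemma cpair_next0 b : cpair b.+1 0 = (cpair 0 b).+1.
Proof.
rewrite /cpair !addn0 add0n.
have ->: b.+1 * b.+2 = b.+1 * 2 + b * b.+1 by lia.
by rewrite divnMDl //; lia.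
Qed.

(** The anti-diagonal of sum [w] has [w.+1] points, so codes on a lower anti-diagonal are strictly
    smaller ([lt]); on a common one the second component decides. *)
Lemma cpair_inj a b c d : cpair a b = cpair c d -> a = c /\ b = d.
Proof.
have tri w : (w.+1 * w.+2) %/ 2 = (w * w.+1) %/ 2 + w.+1.
  have ->: w.+1 * w.+2 = w.+1 * 2 + w * w.+1 by lia.
  by rewrite divnMDl //; lia.
have mono w v : w <= v -> (w * w.+1) %/ 2 <= (v * v.+1) %/ 2.
  by move=> le; apply: leq_div2r; nia.
have lt x y z t : x + y < z + t -> cpair x y < cpair z t.
  move=> h; rewrite /cpair; have := mono _ _ h; rewrite tri; lia.
case: (ltngtP (a + b) (c + d)) => h E.
- by have := lt _ _ _ _ h; rewrite E ltnn.
- by have := lt _ _ _ _ h; rewrite E ltnn.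
- move: E; rewrite /cpair h; lia.
Qed.

(* Walks the anti-diagonals: [unpair x.+1] is the point visited after [unpair x]. *)
Definition unpair (x : nat) : nat * nat :=
  iter x (fun ab => if ab.1 is a.+1 then (a, ab.2.+1) else (ab.2.+1, 0)) (0, 0).
Definition p1 x := (unpair x).1.
Definition p2 x := (unpair x).2.

Lemma cpairK x : cpair (p1 x) (p2 x) = x.
Proof.
rewrite /p1 /p2; elim: x => [|x IH] //.
rewrite /unpair iterS -/(unpair x).
case: (unpair x) IH => [[|a] b] /= IH; first by rewrite cpair_next0 IH.
by rewrite cpair_next IH.
Qed.

Lemma p1K a b : p1 (cpair a b) = a.
Proof. by case: (cpair_inj (cpairK (cpair a b))). Qed.
Lemma p2K a b : p2 (cpair a b) = b.
Proof. by case: (cpair_inj (cpairK (cpair a b))). Qed.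
Lemma p10 : p1 0 = 0. Proof. by []. Qed.
Lemma p20 : p2 0 = 0. Proof. by []. Qed.
Lemma cpair_ge a b : a + b <= cpair a b.
Proof.
rewrite /cpair; suff : a <= ((a + b) * (a + b).+1) %/ 2 by lia.
by rewrite leq_divRL //; nia.
Qed.
Local Opaque cpair p1 p2.

Definition cfun (A : set_nat) (f : nat -> nat) := exists p, forall x, eval A p x (f x).

Definition ind (A : set_nat) (x : nat) : bool :=
  if excluded_middle_informative (A x) then true else false.
Lemma indP A x : reflect (A x) (ind A x).
Proof. by rewrite /ind; case: excluded_middle_informative => h; constructor. Qed.

Lemma eq_cfun A f g : f =1 g -> cfun A f -> cfun A g.
Proof. by move=> E [p h]; exists p => x; rewrite -E. Qed.

Lemma turing_leE X A : turing_le X A <-> cfun A (fun x => ind X x).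
Proof.
split=> -[p h]; exists p => x.
  by case: indP => hx; case: (h x) => h1 h2; [apply: h1 | apply: h2].
by have := h x; case: indP.
Qed.

(* The generated induction principle gives no hypothesis for the evaluations under [exists2] in
   [eMu]. *)
Lemma eval_ind_strong (A : set_nat) (P : prog -> nat -> nat -> Prop) :
  (forall x, P PZero x 0) -> (forall x, P PSucc x x.+1) -> (forall x, P PId x x) ->
  (forall a b, P PFst (cpair a b) a) -> (forall a b, P PSnd (cpair a b) b) ->
  (forall x, P POrac x (ind A x)) ->
  (forall f g x y z, eval A g x y -> P g x y -> eval A f y z -> P f y z -> P (PComp f g) x z) ->
  (forall f g x y z, eval A f x y -> P f x y -> eval A g x z -> P g x z ->
     P (PPair f g) x (cpair y z)) ->
  (forall f g x y, eval A f x y -> P f x y -> P (PRec f g) (cpair x 0) y) ->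
  (forall f g x n y z, eval A (PRec f g) (cpair x n) y -> P (PRec f g) (cpair x n) y ->
     eval A g (cpair (cpair x n) y) z -> P g (cpair (cpair x n) y) z ->
     P (PRec f g) (cpair x n.+1) z) ->
  (forall f x n, eval A f (cpair x n) 0 -> P f (cpair x n) 0 ->
     (forall m, m < n -> exists2 k, k <> 0 & eval A f (cpair x m) k /\ P f (cpair x m) k) ->
     P (PMu f) x n) ->
  forall p x y, eval A p x y -> P p x y.
Proof.
move=> h0 h1 h2 h3 h4 h5 h6 h7 h8 h9 h10.
fix IH 4 => p x y; case.
- exact: h0.
- exact: h1.
- exact: h2.
- exact: h3.
- exact: h4.
- by move=> z hz; have := h5 z; case: indP.
- by move=> z hz; have := h5 z; case: indP.
- by move=> f g a b c e1 e2; apply: (h6 _ _ _ b) => //; apply: IH.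
- by move=> f g a b c e1 e2; apply: h7 => //; apply: IH.
- by move=> f g a b e1; apply: h8 => //; apply: IH.
- by move=> f g a n b c e1 e2; apply: (h9 _ _ _ _ b) => //; apply: IH.
- move=> f a n e1 e2; apply: h10 => //; first exact: IH.
  by move=> m /e2[k k0 ek]; exists k => //; split => //; apply: IH.
Qed.

Ltac inv_eval h :=
  inversion h; clear h; subst;
  repeat match goal with
  | E : cpair _ _ = cpair _ _ |- _ =>
      let E1 := fresh in let E2 := fresh in
      have [E1 E2] := cpair_inj E; clear E; try discriminate; try (injection E2 as E2); subst
  end.

Lemma eval_det A p x y z : eval A p x y -> eval A p x z -> y = z.
Proof.
move=> h; move: p x y h z; apply: eval_ind_strong.
- by move=> x z h; inv_eval h.
- by move=> x z h; inv_eval h.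
- by move=> x z h; inv_eval h.
- by move=> a b z h; inv_eval h.
- by move=> a b z h; inv_eval h.
- by move=> x z h; inv_eval h; case: indP.
- move=> f g x y z _ IH1 _ IH2 w h; inv_eval h.
  by apply: IH2; rewrite (IH1 _ ltac:(eassumption)).
- move=> f g x y z _ IH1 _ IH2 w h; inv_eval h.
  by congr cpair; [apply: IH1|apply: IH2].
- by move=> f g x y _ IH1 w h; inv_eval h; apply: IH1.
- move=> f g x n y z _ IH1 _ IH2 w h; inv_eval h.
  by apply: IH2; rewrite (IH1 _ ltac:(eassumption)).
- move=> f x n _ IH1 IH2 w h; inversion h as [| | | | | | | | | | |? ? ? e1 e2]; subst.
  (* Two distinct search results conflict: at the smaller one the value would be both zero and
     nonzero. *)
  case: (ltngtP n w) => // lt.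
    by case: (e2 _ lt) => k k0 ek; case: k0; rewrite (IH1 _ ek).
  by case: (IH2 _ lt) => k k0 [_ IHk]; case: k0; rewrite (IHk _ e1).
Qed.

Section Closure.
Variable A : set_nat.
Implicit Types f g a b : nat -> nat.

Lemma cf_const c : cfun A (fun=> c).
Proof.
elim: c => [|c [p h]]; first by exists PZero => x; constructor.
by exists (PComp PSucc p) => x; apply: eComp (h x) _; constructor.
Qed.
Lemma cf_id : cfun A (fun x => x).
Proof. by exists PId => x; constructor. Qed.
Lemma cf_comp f a : cfun A f -> cfun A a -> cfun A (fun x => f (a x)).
Proof. by move=> [p h] [q k]; exists (PComp p q) => x; apply: eComp (k x) (h _). Qed.
Lemma cf_S a : cfun A a -> cfun A (fun x => (a x).+1).
Proof. by apply: (cf_comp (f := S)); exists PSucc => x; constructor. Qed.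
Lemma cf_fst : cfun A p1.
Proof. by exists PFst => x; rewrite -{1}(cpairK x); constructor. Qed.
Lemma cf_snd : cfun A p2.
Proof. by exists PSnd => x; rewrite -{1}(cpairK x); constructor. Qed.
Lemma cf_p1 a : cfun A a -> cfun A (fun x => p1 (a x)).
Proof. exact/cf_comp/cf_fst. Qed.
Lemma cf_p2 a : cfun A a -> cfun A (fun x => p2 (a x)).
Proof. exact/cf_comp/cf_snd. Qed.
Lemma cf_pair a b : cfun A a -> cfun A b -> cfun A (fun x => cpair (a x) (b x)).
Proof. by move=> [p h] [q k]; exists (PPair p q) => x; constructor. Qed.
Lemma cf_ind a : cfun A a -> cfun A (fun x => ind A (a x)).
Proof.
apply: (cf_comp (f := fun x => ind A x)); exists POrac => x.
by case: indP => h; constructor.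
Qed.
Lemma cf2 (F : nat -> nat -> nat) a b :
  cfun A (fun z => F (p1 z) (p2 z)) -> cfun A a -> cfun A b -> cfun A (fun x => F (a x) (b x)).
Proof.
move=> hF ha hb; have := cf_comp hF (cf_pair ha hb).
by apply: eq_cfun => x; rewrite p1K p2K.
Qed.
Lemma cf_rec (F : nat -> nat -> nat -> nat) a n :
  cfun A (fun z => F (p1 (p1 z)) (p2 (p1 z)) (p2 z)) -> cfun A a -> cfun A n ->
  cfun A (fun x => nat_rec (fun=> nat) (a x) (F x) (n x)).
Proof.
move=> [p hp] [q hq] [r hr]; exists (PComp (PRec q p) (PPair PId r)) => x.
apply: eComp (ePair (eId _ _) (hr x)) _.
elim: (n x) => [|m IH] /=; first exact: eRec0.
by apply: eRecS IH _; have := hp (cpair (cpair x m) (nat_rec (fun=> nat) (a x) (F x) m));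
  rewrite !(p1K, p2K).
Qed.
Lemma cf_iter (F : nat -> nat -> nat) a n :
  cfun A (fun z => F (p1 z) (p2 z)) -> cfun A a -> cfun A n ->
  cfun A (fun x => iter (n x) (F x) (a x)).
Proof.
move=> hF ha hn; have hF' : cfun A (fun z => F (p1 (p1 z)) (p2 z)).
  by apply: (cf2 hF); [do 2 apply: cf_p1; apply: cf_id | apply/cf_p2/cf_id].
have := cf_rec (F := fun x _ y => F x y) hF' ha hn.
by apply: eq_cfun => x; elim: (n x) => //= m ->.
Qed.
Lemma cf_predn : cfun A predn.
Proof.
have := cf_rec (F := fun _ n _ => n) (cf_p2 cf_fst) (cf_const 0) cf_id.
by apply: eq_cfun; case.
Qed.
Lemma cf_pred a : cfun A a -> cfun A (fun x => (a x).-1).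
Proof. exact/cf_comp/cf_predn. Qed.
Lemma cf_add a b : cfun A a -> cfun A b -> cfun A (fun x => a x + b x).
Proof.
move=> ha hb; have := cf_iter (F := fun _ => S) (cf_S (cf_p2 cf_id)) ha hb.
by apply: eq_cfun => x; rewrite iter_succn addnC.
Qed.
Lemma cf_sub a b : cfun A a -> cfun A b -> cfun A (fun x => a x - b x).
Proof.
move=> ha hb; have := cf_iter (F := fun _ => predn) (cf_pred (cf_p2 cf_id)) ha hb.
by apply: eq_cfun => x; rewrite iter_predn.
Qed.
(** Booleans coerce to [0] and [1]: the test serves as the length of a recursion that starts at [g]
    and whose single step returns [f]. *)
Lemma cf_if (b : nat -> bool) f g : cfun A (fun x => b x) -> cfun A f -> cfun A g ->
  cfun A (fun x => if b x then f x else g x).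
Proof.
move=> hb hf hg; have hf' : cfun A (fun z => f (p1 (p1 z))).
  by apply: cf_comp hf _; do 2 apply: cf_p1; apply: cf_id.
by have := cf_rec (F := fun x _ _ => f x) hf' hg hb; apply: eq_cfun => x; case: (b x).
Qed.
Lemma cf_eq0 a : cfun A a -> cfun A (fun x => a x == 0).
Proof.
move=> ha; have := cf_sub (cf_const 1) ha; apply: eq_cfun => x.
by case: (a x) => // n; rewrite subSS sub0n.
Qed.
Lemma cf_neg (b : nat -> bool) : cfun A (fun x => b x) -> cfun A (fun x => ~~ b x).
Proof.
move=> hb; have := cf_if hb (cf_const 0) (cf_const 1).
by apply: eq_cfun => x; case: (b x).
Qed.
Lemma cf_and (b c : nat -> bool) : cfun A (fun x => b x) -> cfun A (fun x => c x) ->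
  cfun A (fun x => b x && c x).
Proof.
move=> hb hc; have := cf_if hb hc (cf_const 0).
by apply: eq_cfun => x; case: (b x).
Qed.
Lemma cf_or (b c : nat -> bool) : cfun A (fun x => b x) -> cfun A (fun x => c x) ->
  cfun A (fun x => b x || c x).
Proof.
move=> hb hc; have := cf_if hb (cf_const 1) hc.
by apply: eq_cfun => x; case: (b x).
Qed.
Lemma cf_leq a b : cfun A a -> cfun A b -> cfun A (fun x => a x <= b x).
Proof. by move=> ha hb; apply/cf_eq0/cf_sub. Qed.
Lemma cf_eq a b : cfun A a -> cfun A b -> cfun A (fun x => a x == b x).
Proof.
move=> ha hb; have := cf_and (cf_leq ha hb) (cf_leq hb ha).
by apply: eq_cfun => x; rewrite -eqn_leq.
Qed.
Lemma cf_search (b : nat -> nat -> bool) : cfun A (fun z => b (p1 z) (p2 z)) ->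
  (forall x, exists n, b x n) -> exists2 m, cfun A m & forall x, b x (m x).
Proof.
move=> hb ex; have [p hp] := cf_neg hb.
exists (fun x => ex_minn (ex x)); last by move=> x; case: ex_minnP.
exists (PMu p) => x; case: ex_minnP => n hn mn; apply: eMu.
  by have := hp (cpair x n); rewrite p1K p2K hn.
move=> m lt; exists 1 => //; have := hp (cpair x m); rewrite p1K p2K.
by case: (b x m) (mn m) => // /(_ isT); rewrite leqNgt lt.
Qed.
End Closure.

Create HintDb cf.
#[global] Hint Constants Opaque : cf.
#[global] Hint Resolve cf_const cf_id cf_fst cf_snd cf_S cf_p1 cf_p2 cf_pair cf_pred cf_predn
  cf_add cf_sub cf_if cf_neg cf_and cf_or cf_leq cf_eq cf_ind : cf.
Ltac cf := cbv beta; typeclasses eauto with cf nocore.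

(** * A universal machine *)

(** Same form as the cons clause of [code_seq], so [lhd] and [ltl] also read lists coded by it; [0]
    is the empty list. *)
Definition lcons x s := (cpair x s).+1.
Definition lhd s := p1 s.-1.
Definition ltl s := p2 s.-1.
Lemma lhdK x s : lhd (lcons x s) = x. Proof. by rewrite /lhd p1K. Qed.
Lemma ltlK x s : ltl (lcons x s) = s. Proof. by rewrite /ltl p2K. Qed.
Lemma cf_lcons A a b : cfun A a -> cfun A b -> cfun A (fun x => lcons (a x) (b x)).
Proof. by move=> *; apply/cf_S/cf_pair. Qed.
Lemma cf_lhd A a : cfun A a -> cfun A (fun x => lhd (a x)).
Proof. by move=> *; apply/cf_p1/cf_pred. Qed.
Lemma cf_ltl A a : cfun A a -> cfun A (fun x => ltl (a x)).
Proof. by move=> *; apply/cf_p2/cf_pred. Qed.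
#[global] Hint Resolve cf_lcons cf_lhd cf_ltl : cf.

(** A numbering that can be read by projections alone, unlike the tree codes behind [decode_prog];
    [prog_index] translates those into this one, up to a shift by one. *)
Fixpoint pc (p : prog) : nat :=
  match p with
  | PZero => cpair 0 0
  | PSucc => cpair 1 0
  | PId => cpair 2 0
  | PFst => cpair 3 0
  | PSnd => cpair 4 0
  | POrac => cpair 5 0
  | PComp f g => cpair 6 (cpair (pc f) (pc g))
  | PPair f g => cpair 7 (cpair (pc f) (pc g))
  | PRec f g => cpair 8 (cpair (pc f) (pc g))
  | PMu f => cpair 9 (pc f)
  end.

(* A state is a stack of tasks paired with a current value. Tasks with tags 0 to 9 are programs to be
   run on the value (tags as in [pc]); tags 10 to 13 are the continuations [PairL], [PairR], [RecK]
   and [MuK] below. The machine has halted when the stack is empty. *)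
Definition step (o : nat -> bool) (z : nat) : nat :=
  let K := p1 z in let v := p2 z in
  if K == 0 then z else
  let t := p1 (lhd K) in let d := p2 (lhd K) in let R := ltl K in
  if t == 0 then cpair R 0 else
  if t == 1 then cpair R v.+1 else
  if t == 2 then cpair R v else
  if t == 3 then cpair R (p1 v) else
  if t == 4 then cpair R (p2 v) else
  if t == 5 then cpair R (o v) else
  if t == 6 then cpair (lcons (p2 d) (lcons (p1 d) R)) v else
  if t == 7 then cpair (lcons (p1 d) (lcons (cpair 10 (cpair (p2 d) v)) R)) v else
  if t == 8 then
    cpair (lcons (p1 d) (lcons (cpair 12 (cpair (p2 d) (cpair (p1 v) (cpair 0 (p2 v))))) R)) (p1 v)
  else
  if t == 9 then cpair (lcons d (lcons (cpair 13 (cpair d (cpair v 0))) R)) (cpair v 0) else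
  if t == 10 then cpair (lcons (p1 d) (lcons (cpair 11 v) R)) (p2 d) else
  if t == 11 then cpair R (cpair d v) else
  if t == 12 then
    let g := p1 d in let x := p1 (p2 d) in let n := p1 (p2 (p2 d)) in let k := p2 (p2 (p2 d)) in
    if k == 0 then cpair R v
    else cpair (lcons g (lcons (cpair 12 (cpair g (cpair x (cpair n.+1 k.-1)))) R))
           (cpair (cpair x n) v) else
  let f := p1 d in let x := p1 (p2 d) in let m := p2 (p2 d) in
  if v == 0 then cpair R m
  else cpair (lcons f (lcons (cpair 13 (cpair f (cpair x m.+1))) R)) (cpair x m.+1).

Lemma cf_step A a : cfun A a -> cfun A (fun x => step (ind A) (a x)).
Proof. rewrite /step => ha. cf. Qed.
#[global] Hint Resolve cf_step : cf.

(* In [RecK g x n k], the value is that of the recursion at [n] and [k] steps remain; in [MuK f x m],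
   it is that of [f] on [cpair x m]. *)
Notation Do p K := (lcons (pc p) K).
Notation PairL g x K := (lcons (cpair 10 (cpair (pc g) x)) K).
Notation PairR y K := (lcons (cpair 11 y) K).
Notation RecK g x n k K := (lcons (cpair 12 (cpair (pc g) (cpair x (cpair n k)))) K).
Notation MuK f x m K := (lcons (cpair 13 (cpair (pc f) (cpair x m))) K).

Section Machine.
Variable A : set_nat.
Let st := step (ind A).

Let stepE K v : st (cpair K v) =
  ltac:(let t := eval cbv beta zeta delta [step] in (step (ind A) (cpair K v)) in exact t).
Proof. by []. Qed.

Ltac stp := by rewrite stepE !(p1K, p2K, lhdK, ltlK).
Lemma st0 v : st (cpair 0 v) = cpair 0 v. Proof. stp. Qed.
Lemma stZero K v : st (cpair (Do PZero K) v) = cpair K 0. Proof. stp. Qed.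
Lemma stSucc K v : st (cpair (Do PSucc K) v) = cpair K v.+1. Proof. stp. Qed.
Lemma stId K v : st (cpair (Do PId K) v) = cpair K v. Proof. stp. Qed.
Lemma stFst K v : st (cpair (Do PFst K) v) = cpair K (p1 v). Proof. stp. Qed.
Lemma stSnd K v : st (cpair (Do PSnd K) v) = cpair K (p2 v). Proof. stp. Qed.
Lemma stOrac K v : st (cpair (Do POrac K) v) = cpair K (ind A v). Proof. stp. Qed.
Lemma stComp f g K v : st (cpair (Do (PComp f g) K) v) = cpair (Do g (Do f K)) v.
Proof. stp. Qed.
Lemma stPair f g K v : st (cpair (Do (PPair f g) K) v) = cpair (Do f (PairL g v K)) v.
Proof. stp. Qed.
Lemma stRec f g K x k :
  st (cpair (Do (PRec f g) K) (cpair x k)) = cpair (Do f (RecK g x 0 k K)) x.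
Proof. stp. Qed.
Lemma stMu f K v : st (cpair (Do (PMu f) K) v) = cpair (Do f (MuK f v 0 K)) (cpair v 0).
Proof. stp. Qed.
Lemma stPairL g x K v : st (cpair (PairL g x K) v) = cpair (Do g (PairR v K)) x.
Proof. stp. Qed.
Lemma stPairR y K v : st (cpair (PairR y K) v) = cpair K (cpair y v).
Proof. stp. Qed.
Lemma stRecK0 g x n K v : st (cpair (RecK g x n 0 K) v) = cpair K v.
Proof. stp. Qed.
Lemma stRecKS g x n k K v : st (cpair (RecK g x n k.+1 K) v) =
  cpair (Do g (RecK g x n.+1 k K)) (cpair (cpair x n) v).
Proof. stp. Qed.
Lemma stMuK0 f x m K : st (cpair (MuK f x m K) 0) = cpair K m.
Proof. stp. Qed.
Lemma stMuKS f x m K v : st (cpair (MuK f x m K) v.+1) =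
  cpair (Do f (MuK f x m.+1 K)) (cpair x m.+1).
Proof. stp. Qed.

Definition reach z w := exists t, iter t st z = w.
Lemma reach_refl z : reach z z. Proof. by exists 0. Qed.
Lemma reach_trans w z u : reach z w -> reach w u -> reach z u.
Proof. by move=> [s <-] [t <-]; exists (t + s); rewrite iterD. Qed.
Lemma reach_step z w : reach (st z) w -> reach z w.
Proof. by move=> [t <-]; exists t.+1; rewrite iterSr. Qed.

Lemma eval_reach p x y : eval A p x y -> forall K, reach (cpair (Do p K) x) (cpair K y).
Proof.
(* The derivation of a recursion passes through its value at [n], while the machine runs a single
   loop upward from [0]. The induction hypothesis at [n] must therefore describe that loop with [k]
   more rounds pending. *)
move=> h; have [] : (forall K, reach (cpair (Do p K) x) (cpair K y)) /\
  forall f g a n, p = PRec f g -> x = cpair a n -> forall K k,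
    reach (cpair (Do f (RecK g a 0 (n + k) K)) a) (cpair (RecK g a n k K) y); last by [].
have rec f g a n z : (forall K k,
    reach (cpair (Do f (RecK g a 0 (n + k) K)) a) (cpair (RecK g a n k K) z)) ->
  forall K, reach (cpair (Do (PRec f g) K) (cpair a n)) (cpair K z).
  move=> H K; apply: reach_step; rewrite stRec -[X in cpair 0 X]addn0.
  apply: reach_trans (H _ _) _; apply: reach_step; rewrite stRecK0; exact: reach_refl.
move: p x y h; apply: eval_ind_strong.
- by move=> x; split=> // K; apply: reach_step; rewrite stZero; apply: reach_refl.
- by move=> x; split=> // K; apply: reach_step; rewrite stSucc; apply: reach_refl.
- by move=> x; split=> // K; apply: reach_step; rewrite stId; apply: reach_refl.
- by move=> a b; split=> // K; apply: reach_step; rewrite stFst p1K; apply: reach_refl.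
- by move=> a b; split=> // K; apply: reach_step; rewrite stSnd p2K; apply: reach_refl.
- by move=> x; split=> // K; apply: reach_step; rewrite stOrac; apply: reach_refl.
- move=> f g x y z _ [IH1 _] _ [IH2 _]; split=> // K; apply: reach_step; rewrite stComp.
  exact: reach_trans (IH1 _) (IH2 _).
- move=> f g x y z _ [IH1 _] _ [IH2 _]; split=> // K; apply: reach_step; rewrite stPair.
  apply: reach_trans (IH1 _) _; apply: reach_step; rewrite stPairL.
  by apply: reach_trans (IH2 _) _; apply: reach_step; rewrite stPairR; apply: reach_refl.
- move=> f g x y _ [IH _]; have H K k : reach (cpair (Do f (RecK g x 0 (0 + k) K)) x)
    (cpair (RecK g x 0 k K) y) by apply: IH.
  split=> [|f' g' a n [<- <-] /cpair_inj[<- <-]]; [exact: rec | exact: H].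
- move=> f g x n y z _ [_ IH1] _ [IH2 _].
  have H K k : reach (cpair (Do f (RecK g x 0 (n.+1 + k) K)) x) (cpair (RecK g x n.+1 k K) z).
    rewrite addSnnS; apply: reach_trans (IH1 f g x n erefl erefl K k.+1) _.
    by apply: reach_step; rewrite stRecKS; apply: IH2.
  split=> [|f' g' a m [<- <-] /cpair_inj[<- <-]]; [exact: rec | exact: H].
- move=> f x n _ [IH1 _] IH2; split=> // K; apply: reach_step; rewrite stMu.
  have H m : m <= n ->
      reach (cpair (Do f (MuK f x 0 K)) (cpair x 0)) (cpair (Do f (MuK f x m K)) (cpair x m)).
    elim: m => [|m IH] lt; first exact: reach_refl.
    apply: reach_trans (IH (ltnW lt)) _.
    have [[|k] // _ [_ [Hk _]]] := IH2 _ lt; apply: reach_trans (Hk _) _.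
    by apply: reach_step; rewrite stMuKS; apply: reach_refl.
  apply: reach_trans (H n (leqnn n)) _; apply: reach_trans (IH1 _) _.
  by apply: reach_step; rewrite stMuK0; apply: reach_refl.
Qed.

Let hlt t z := p1 (iter t st z) = 0.

Lemma hlt_cons t i K v : hlt t (cpair (lcons i K) v) ->
  exists2 u, u < t & hlt u (st (cpair (lcons i K) v)).
Proof.
case: t => [|t]; first by rewrite /hlt p1K.
by rewrite /hlt iterSr => h; exists t.
Qed.

(** Induction on [p]: a run that empties the stack must first complete its top task. The strict drop
    from [t] to [u] serves the search case, where the number of rounds is unknown and the induction
    is on the remaining time; recursion uses an inner induction on the pending rounds [k]. *)
Lemma hlt_eval p : forall t K x, hlt t (cpair (Do p K) x) ->
  exists y, exists2 u, u < t & eval A p x y /\ hlt u (cpair K y).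
Proof.
have base f t K x y z : eval A f x y -> (exists2 u, u < t & hlt u z) -> z = cpair K y ->
    exists y, exists2 u, u < t & eval A f x y /\ hlt u (cpair K y).
  by move=> e [u lt h] E; exists y, u => //; rewrite -E.
elim: p => [|||||| f IHf g IHg | f IHf g IHg | f IHf g IHg | f IHf] t K x h.
- by apply: base (eZero _ _) (hlt_cons h) (stZero _ _).
- by apply: base (eSucc _ _) (hlt_cons h) (stSucc _ _).
- by apply: base (eId _ _) (hlt_cons h) (stId _ _).
- by apply: base (hlt_cons h) (stFst _ _); rewrite -{1}(cpairK x); constructor.
- by apply: base (hlt_cons h) (stSnd _ _); rewrite -{1}(cpairK x); constructor.
- by apply: base (hlt_cons h) (stOrac _ _); case: indP => hx; constructor.
- have [t1 l1] := hlt_cons h; rewrite stComp => /IHg[y [t2 l2 [e2]]] /IHf[z [t3 l3 [e3 h3]]].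
  by exists z, t3; [lia | split=> //; apply: eComp e2 e3].
- have [t1 l1] := hlt_cons h; rewrite stPair => /IHf[y [t2 l2 [e2]]] /hlt_cons[t3 l3].
  rewrite stPairL => /IHg[z [t4 l4 [e4]]] /hlt_cons[t5 l5]; rewrite stPairR => h5.
  by exists (cpair y z), t5; [lia | split=> //; constructor].
- have loop k : forall n y u a, eval A (PRec f g) (cpair a n) y ->
      hlt u (cpair (RecK g a n k K) y) ->
      exists z, exists2 w, w < u & eval A (PRec f g) (cpair a (n + k)) z /\ hlt w (cpair K z).
    elim: k => [|k IH] n y u a e /hlt_cons[t1 l1].
      by rewrite stRecK0 addn0 => h1; exists y, t1.
    rewrite stRecKS => /IHg[z [t2 l2 [e2]]] /(IH _ _ _ _ (eRecS e e2))[v [w l3]].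
    by rewrite addSnnS => ?; exists v, w => //; lia.
  have [t1 l1] := hlt_cons h; rewrite -(cpairK x) stRec => /IHf[y [t2 l2 [e2]]].
  move=> /(loop _ _ _ _ _ (eRec0 _ e2))[z [w l3 ?]].
  by exists z, w => //; lia.
- have loop t1 : forall m, (forall i, i < m -> exists2 k, k <> 0 & eval A f (cpair x i) k) ->
      hlt t1 (cpair (Do f (MuK f x m K)) (cpair x m)) ->
      exists z, exists2 w, w < t1 & eval A (PMu f) x z /\ hlt w (cpair K z).
    elim/ltn_ind: t1 => t1 IH m hm /IHf[[|k] [t2 l2 [e2]]] /hlt_cons[t3 l3].
      by rewrite stMuK0 => h3; exists m, t3; [lia | split=> //; apply: eMu].
    rewrite stMuKS => h3; have [||z [w lw ?]] := IH t3 _ _ _ h3; first by lia.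
      move=> i; rewrite ltnS leq_eqVlt => /orP[/eqP->|/hm//]; by exists k.+1.
    by exists z, w => //; lia.
  have [t1 l1] := hlt_cons h; rewrite stMu => h1.
  have [//|z [w lw ?]] := loop _ _ _ h1.
  by exists z, w => //; lia.
Qed.

(* [0] while the computation is running, and the output plus one afterwards. *)
Definition stage (c x s : nat) : nat :=
  let z := iter s (step (ind A)) (cpair (lcons c 0) x) in if p1 z == 0 then (p2 z).+1 else 0.

Lemma iter_halted s y : iter s st (cpair 0 y) = cpair 0 y.
Proof. by elim: s => //= s ->; apply: st0. Qed.

Lemma stage_complete p x y : eval A p x y -> exists N, forall s, N <= s -> stage (pc p) x s = y.+1.
Proof.
move=> /eval_reach /(_ 0)[N E]; exists N => s le.
by rewrite /stage -(subnK le) iterD E iter_halted p1K eqxx p2K.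
Qed.

(** [hlt_eval] yields some true output [z]; completeness fixes all late stages at [z], and a halted
    state never changes, so stage [s] already shows [z]. *)
Lemma stage_sound p x s y : stage (pc p) x s = y.+1 -> eval A p x y.
Proof.
move=> E; have /hlt_eval[z [_ _ [e _]]] : hlt s (cpair (Do p 0) x).
  by move: E; rewrite /stage /hlt; case: eqP.
suff -> : y = z by [].
have [N hN] := stage_complete e.
have := hN (s + N) (leq_addl _ _); move: E; rewrite /stage addnC iterD.
case: eqP => // E [<-]; set w := iter s _ _ in E *.
by rewrite -[w]cpairK E iter_halted p1K p2K eqxx => -[].
Qed.

Lemma stage_spec p x y : eval A p x y <-> exists s, stage (pc p) x s = y.+1.
Proof.
split; last by move=> [s]; apply: stage_sound.
by move=> /stage_complete[N h]; exists N; apply: h.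
Qed.
End Machine.

Lemma cf_stage A a b c : cfun A a -> cfun A b -> cfun A c ->
  cfun A (fun x => stage A (a x) (b x) (c x)).
Proof.
move=> ha hb hc; have h : cfun A (fun x => iter (c x) (step (ind A)) (cpair (lcons (a x) 0) (b x))).
  by apply: (@cf_iter _ (fun _ y => step (ind A) y)); cf.
by rewrite /stage; cf.
Qed.
#[global] Hint Resolve cf_stage : cf.

(** * Decoding program indices *)

(** The state pairs the accumulator with the rest of the list. The code itself bounds the number of
    iterations, since no list is longer than its code. *)
Definition lfold (F : nat -> nat -> nat) (a c : nat) : nat :=
  p1 (iter c (fun z => if p2 z == 0 then z else cpair (F (p1 z) (lhd (p2 z))) (ltl (p2 z)))
        (cpair a c)).

Lemma lfoldE F a s : lfold F a (code_seq s) = foldl F a s.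
Proof.
have size_code t : size t <= code_seq t.
  by elim: t => //= x t IH; apply: leq_ltn_trans IH _; rewrite ltnS; have := cpair_ge x (code_seq t); lia.
rewrite /lfold; set G := fun z => _.
have G0 n b : iter n G (cpair b 0) = cpair b 0.
  by elim: n => //= n ->; rewrite /G p2K.
move: (size_code s); move: {1 2}(code_seq s) => n.
elim: s a n => [|x s IH] a [|n] //= le; rewrite ?p1K // -?iterS ?G0 ?p1K //.
by rewrite iterSr {2}/G p1K p2K -/(lcons x (code_seq s)) lhdK ltlK; apply: IH.
Qed.

Lemma cf_lfold A F a c : cfun A (fun z => F (p1 z) (p2 z)) -> cfun A a -> cfun A c ->
  cfun A (fun x => lfold F (a x) (c x)).
Proof.
move=> hF ha hc; apply: cf_p1.
pose G z := if p2 z == 0 then z else cpair (F (p1 z) (lhd (p2 z))) (ltl (p2 z)).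
suff hG : cfun A G.
  by apply: (@cf_iter _ (fun _ => G)) => //; [apply: cf_comp hG _; cf | cf].
have h : cfun A (fun z => F (p1 z) (lhd (p2 z))) by apply: (cf2 hF); cf.
by rewrite /G; cf.
Qed.

(* One unfolding of [CodeSeq.decode_rec v q r], on states [cpair (cpair q r) (cpair v acc)]. *)
Definition unseq_step (z : nat) : nat :=
  let q := (p1 (p1 z)).-1 in let r := p2 (p1 z) in let v := p1 (p2 z) in let s := p2 (p2 z) in
  if r == 0 then cpair (cpair q q) (cpair 0 (lcons v s))
  else if r == 1 then cpair (cpair q q) (cpair v.+1 s)
  else cpair (cpair q r.-2) (cpair v s).

(** Accumulating reverses the list, so a left fold over [drev n] is a right fold over the decoded
    list. Each step lowers [q] by one, hence the [n.-1] iterations. *)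
Definition drev (n : nat) : nat :=
  if n == 0 then 0 else
  let z := iter n.-1 unseq_step (cpair (cpair n.-1 n.-1) (cpair 0 0)) in lcons (p1 (p2 z)) (p2 (p2 z)).

Lemma drevE n : drev n = code_seq (rev (CodeSeq.decode n)).
Proof.
have H q : forall r v s,
    let z := iter q unseq_step (cpair (cpair q r) (cpair v (code_seq s))) in
    lcons (p1 (p2 z)) (p2 (p2 z)) = code_seq (catrev (CodeSeq.decode_rec v q r) s).
  elim: q => [|q IH] r v s z; first by rewrite /z /= !(p1K, p2K).
  have -> : z = iter q unseq_step (unseq_step (cpair (cpair q.+1 r) (cpair v (code_seq s)))).
    by rewrite /z iterSr.
  rewrite /unseq_step !(p1K, p2K).
  by case: r {z} => [|[|r]]; rewrite -?IH.
by case: n => [|m] //; apply: (H m m 0 [::]).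
Qed.

Lemma cf_drev A : cfun A drev.
Proof.
have h : cfun A (fun x => iter x.-1 unseq_step (cpair (cpair x.-1 x.-1) (cpair 0 0))).
  by apply: (@cf_iter _ (fun _ => unseq_step)); rewrite /unseq_step; cf.
by rewrite /drev; cf.
Qed.
Lemma cf_drev_comp A a : cfun A a -> cfun A (fun x => drev (a x)).
Proof. exact/cf_comp/cf_drev. Qed.
#[global] Hint Resolve cf_drev cf_drev_comp : cf.

(** A sum is stored as a pair of options, the pair as a two-entry list, each option as a list read
    through its head. Any entry decodes to the unit, hence the constant map. *)
Lemma unpickle_tokenE n : unpickle n = (if CodeSeq.decode n is [:: a; b] then
  sum_of_opair (ohead (CodeSeq.decode a), ohead (map (fun=> tt) (CodeSeq.decode b))) else None)
  :> option (nat + unit).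
Proof.
rewrite /unpickle /= /pcomp /unpickle /= /pcomp /unpickle /=.
rewrite /unpickle_tagged.
case: (CodeSeq.decode n) => [|a [|b [|c l]]] //=.
have pmapE (l : seq nat) : pmap unpickle l = l by elim: l => //= x l ->.
by rewrite /pair_of_tag /= pmapE; case: (CodeSeq.decode b).
Qed.

(* Tokens of [GenTree.encode]: [0] for junk, [1] for [inr tt], [m.+2] for [inl m]. *)
Definition token (n : nat) : nat :=
  let l := drev n in let a := lhd (ltl l) in
  if (l != 0) && (ltl l != 0) && (ltl (ltl l) == 0) then
    if lhd l != 0 then 1 else
    if a == 0 then 0 else (lfold (fun _ x => x) 0 (drev a)).+2
  else 0.

Lemma cf_token A a : cfun A a -> cfun A (fun x => token (a x)).
Proof.
apply: cf_comp; rewrite /token.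
have h : cfun A (fun n => lfold (fun _ x => x) 0 (drev (lhd (ltl (drev n))))).
  by apply: cf_lfold; cf.
cf.
Qed.

Lemma decode_eq0 n : (n == 0) = (CodeSeq.decode n == [::]).
Proof.
rewrite -[in LHS](CodeSeq.decodeK n); case: (CodeSeq.decode n) => //= a l.
by rewrite muln_eq0 expn_eq0.
Qed.

(** In the reversed list the unit option comes first, and [sum_of_opair] gives it priority. Folding
    with [fun _ x => x] keeps the last entry of a reversed list, that is, the original head. *)
Lemma tokenE n : token n = match unpickle n : option (nat + unit) with
  | Some (inl m) => m.+2 | Some (inr _) => 1 | None => 0 end.
Proof.
rewrite unpickle_tokenE /token !drevE lfoldE.
case: (CodeSeq.decode n) => [|a [|b [|c l]]] //=.
- by rewrite /rev /= -/(lcons a 0) ltlK.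
- rewrite /rev /= -/(lcons a 0) -/(lcons b (lcons a 0)) !(ltlK, lhdK) /= !decode_eq0.
  case: (CodeSeq.decode b) => [|? ?] //=.
  case: (CodeSeq.decode a) => [|x l] //=.
  by rewrite catrevE foldl_cat.
- have [x [y [z [t E]]]] : exists x y z t, rev [:: a, b, c & l] = [:: x, y, z & t].
    by have := size_rev [:: a, b, c & l]; case: rev => [|x [|y [|z t]]] //= _; exists x, y, z, t.
  by rewrite E /= -!/(lcons _ _) !(ltlK, lhdK).
Qed.

Definition pcode (op : option prog) : nat := if op is Some p then (pc p).+1 else 0.
Definition tcode (t : GenTree.tree unit) := pcode (tree_to_prog t).

(* [tree_to_prog] as a fold: [l] lists the values of the subtrees. *)
Definition node_code (n l : nat) : nat :=
  let x := lhd l in let y := lhd (ltl l) in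
  if n <= 5 then if l == 0 then (cpair n 0).+1 else 0
  else if n <= 8 then
    if [&& l != 0, ltl l != 0, ltl (ltl l) == 0, x != 0 & y != 0] then
      (cpair n (cpair x.-1 y.-1)).+1 else 0
  else if n == 9 then if [&& l != 0, ltl l == 0 & x != 0] then (cpair 9 x.-1).+1 else 0
  else 0.

Lemma node_codeE n fs : tcode (GenTree.Node n fs) = node_code n (code_seq (map tcode fs)).
Proof.
rewrite /node_code; case: fs => [|f [|g [|h fs]]].
- by do 10![case: n => [|n] //].
- rewrite /= -/(lcons (tcode f) 0) lhdK ltlK /tcode.
  by case E: (tree_to_prog f); do 10![case: n => [|n]; rewrite /= ?E //].
- rewrite /= -/(lcons (tcode g) 0) -/(lcons (tcode f) _) !(lhdK, ltlK) /tcode.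
  by case E: (tree_to_prog f); case E': (tree_to_prog g);
     do 10![case: n => [|n]; rewrite /= ?E ?E' //].
- rewrite /= -/(lcons (tcode h) _) -/(lcons (tcode g) _) -/(lcons (tcode f) _) !(lhdK, ltlK) /tcode.
  by do 10![case: n => [|n]; rewrite //= ?andbF].
Qed.

(** Arithmetic counterpart of [GenTree.decode_step] that keeps only the [tcode] of each subtree. A
    leaf is no program and has code [0]; token [2] is the closing mark [inl 0], and [k.-2.-1]
    recovers [m] from the token of [inl m.+1]. *)
Definition tree_step (z n : nat) : nat :=
  let k := token n in let l := p1 z in let ll := p2 z in
  if k == 0 then z
  else if k == 1 then cpair (lcons 0 l) ll
  else if k == 2 then cpair 0 (lcons l ll)
  else cpair (lcons (node_code k.-2.-1 l) (lhd ll)) (ltl ll).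

Definition prog_index (e : nat) : nat := lhd (p1 (lfold tree_step (cpair 0 0) (drev e))).

Lemma cf_prog_index A a : cfun A a -> cfun A (fun x => prog_index (a x)).
Proof.
have ht := cf_token.
apply: cf_comp; rewrite /prog_index; apply/cf_lhd/cf_p1/cf_lfold; [|cf|cf].
rewrite /tree_step /node_code; cf.
Qed.
#[global] Hint Resolve cf_prog_index : cf.

Lemma prog_indexE e : prog_index e = pcode (decode_prog e).
Proof.
rewrite /decode_prog /unpickle /= /pcomp /unpickle /= /GenTree.decode /prog_index drevE lfoldE foldl_rev.
set G := fun _ => _.
(* [cst] codes a decoder state; each step of the arithmetic fold commutes with it, and junk tokens,
   dropped by [pmap], leave the state alone. *)
pose cst (fs : seq (GenTree.tree unit) * seq (seq (GenTree.tree unit))) :=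
  cpair (code_seq (map tcode fs.1)) (code_seq (map (fun l => code_seq (map tcode l)) fs.2)).
have -> l : foldr G (cpair 0 0) l =
    cst (foldr (@GenTree.decode_step unit) ([::], [::]) (pmap unpickle l)).
  elim: l => //= n l ->; rewrite {1}/G /tree_step tokenE.
  case: unpickle => [[[|m]|u]|] //=; move: (foldr _ _ _) => -[a b]; rewrite /cst /= !(p1K, p2K) //.
  by rewrite -node_codeE /lhd /ltl; case: b => [|b c] /=; rewrite ?(p10, p20, p1K, p2K).
rewrite /cst p1K; case: (foldr _ _ _).1 => [|t l] /=; first by rewrite /lhd p10.
by rewrite -/(lcons _ _) lhdK.
Qed.

(** * Reducibility, the jump and the limit lemma *)

(** Every oracle query in the program is replaced by the program [q] that decides [B] from [A]. *)
Lemma cfun_trans A B f : turing_le B A -> cfun B f -> cfun A f.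
Proof.
move=> [q hq] [p hp].
pose fix sub p := match p with
  | POrac => q
  | PComp f g => PComp (sub f) (sub g)
  | PPair f g => PPair (sub f) (sub g)
  | PRec f g => PRec (sub f) (sub g)
  | PMu f => PMu (sub f)
  | p => p end.
suff sub_eval r x y : eval B r x y -> eval A (sub r) x y by exists (sub p) => x; apply: sub_eval.
move: r x y {p f hp}; apply: eval_ind_strong => /=; try by constructor.
- by move=> x; have [] := hq x; case: indP => h; [move/(_ h) | move=> _ /(_ h)].
- by move=> f g x y z _ h1 _ h2; apply: eComp h1 h2.
- by move=> f g x n y z _ h1 _ h2; apply: eRecS h1 h2.
- by move=> f x n _ h1 h2; constructor=> // m /h2[k k0 [_ h]]; exists k.
Qed.

Lemma turing_le_trans B A C : turing_le A B -> turing_le B C -> turing_le A C.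
Proof. by move=> /turing_leE h hBC; apply/turing_leE; apply: cfun_trans hBC h. Qed.

Lemma turing_le_reduce A B e : cfun B e -> (forall x, A x <-> B (e x)) -> turing_le A B.
Proof.
move=> he h; apply/turing_leE; have hi : cfun B (fun x => ind B (e x)) by cf.
by apply: eq_cfun hi => x; congr nat_of_bool; apply/indP/indP => /h.
Qed.

Lemma computable_le X A : computable X -> turing_le X A.
Proof.
move=> hX; apply: turing_le_trans hX _; apply/turing_leE.
by apply: eq_cfun (cf_const A 0) => x; case: indP.
Qed.

Lemma join_lel X Y : turing_le X (join X Y).
Proof.
apply: (@turing_le_reduce _ _ (fun x => x + x)); first by cf.
move=> x; rewrite addnn; split=> [h|[[k [/double_inj -> //]]|[k [E _]]]]; first by left; exists x.
by have := congr1 odd E; rewrite /= !odd_double.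
Qed.

Lemma join_ler X Y : turing_le Y (join X Y).
Proof.
apply: (@turing_le_reduce _ _ (fun x => (x + x).+1)); first by cf.
move=> x; rewrite addnn; split=> [h|[[k [E _]]|[k [[/double_inj -> //]]]]]; first by right; exists x.
by have := congr1 odd E; rewrite /= !odd_double.
Qed.

Lemma join_lub X Y A : turing_le X A -> turing_le Y A -> turing_le (join X Y) A.
Proof.
move=> /turing_leE hX /turing_leE hY.
(* The iteration yields the two roundings of [x / 2], down and up; they agree exactly when [x] is
   even. *)
pose half := fun x => iter x (fun z => cpair (p2 z) (p1 z).+1) (cpair 0 0).
have halfE x : half x = cpair x./2 (uphalf x).
  by elim: x => // x IH; rewrite /half iterS -/(half x) IH p1K p2K.
have hh : cfun A half by apply: (@cf_iter _ (fun _ z => cpair (p2 z) (p1 z).+1)); cf.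
have hXh : cfun A (fun x => ind X (p1 (half x))) by apply: (cf_comp hX); cf.
have hYh : cfun A (fun x => ind Y (p1 (half x))) by apply: (cf_comp hY); cf.
apply/turing_leE.
have : cfun A (fun x => if p1 (half x) == p2 (half x) then nat_of_bool (ind X (p1 (half x)))
                 else ind Y (p1 (half x))) by cf.
apply: eq_cfun => x; rewrite halfE p1K p2K uphalf_half -[x in RHS]odd_double_half.
case: (odd x) => /=; rewrite ?add0n ?add1n ?(eqxx, eqn_leq, leqnn, ltnn, andbF).
  congr nat_of_bool; apply/indP/indP => [h|[[k [E _]]|[k [[/double_inj -> //]]]]].
    by right; exists x./2.
  by have := congr1 odd E; rewrite /= !odd_double.
congr nat_of_bool; apply/indP/indP => [h|[[k [/double_inj -> //]]|[k [E _]]]].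
  by left; exists x./2.
by have := congr1 odd E; rewrite /= !odd_double.
Qed.

Definition sigma1 (A S : set_nat) := exists2 b : nat -> nat -> bool,
  cfun A (fun z => b (p1 z) (p2 z)) & forall x, S x <-> exists n, b x n.

Lemma jumpE A e : jump A e <-> exists s, (prog_index e != 0) && (stage A (prog_index e).-1 e s != 0).
Proof.
rewrite /jump prog_indexE; split.
  by move=> [p -> [y /stage_spec[s E]]]; exists s; rewrite /= E.
case: decode_prog => [p|] [s] //=; case E: (stage _ _ _ _) => [|y] // _.
by exists p => //; exists y; apply: stage_sound E.
Qed.

Lemma sigma1_jump A : sigma1 A (jump A).
Proof.
exists (fun e s => (prog_index e != 0) && (stage A (prog_index e).-1 e s != 0)); last exact: jumpE.
cf.
Qed.

(* [x] is sent to an index of the program that ignores its input and searches for a witness for [x];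
   the index is found by unbounded search, so that no encoder has to be computed. *)
Lemma sigma1_le_jump A S : sigma1 A S -> turing_le S (jump A).
Proof.
move=> [b hb hS]; have [q hq] := cf_neg hb.
have hqS x : S x <-> exists y, eval A (PMu q) x y.
  rewrite hS; split=> [ex|[y h]].
    exists (ex_minn ex); case: ex_minnP => n hn mn; constructor.
      by have := hq (cpair x n); rewrite p1K p2K hn.
    move=> m lt; exists 1 => //; have := hq (cpair x m); rewrite p1K p2K.
    by case: (b x m) (mn m) => // /(_ isT); rewrite leqNgt lt.
  exists y; inversion h as [| | | | | | | | | | |? ? ? e1 e2]; subst.
  have := hq (cpair x y); rewrite p1K p2K => e; have := eval_det e e1.
  by case: (b x y).
pose K x := iter x (PComp PSucc) PZero.
have KE x e : eval A (K x) e x by elim: x => [|x IH]; [constructor|apply: eComp IH _; constructor].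
pose c x := pc (PComp (PMu q) (K x)).
have hc : cfun (jump A) c.
  have hk : cfun (jump A) (fun x => iter x (fun k => cpair 6 (cpair (cpair 1 0) k)) (cpair 0 0)).
    by apply: (@cf_iter _ (fun _ k => cpair 6 (cpair (cpair 1 0) k))); cf.
  have h : cfun (jump A) (fun x => cpair 6 (cpair (pc (PMu q))
    (iter x (fun k => cpair 6 (cpair (cpair 1 0) k)) (cpair 0 0)))) by cf.
  by apply: eq_cfun h => x; rewrite /c /=; congr (cpair _ (cpair _ _)); elim: x => //= x ->.
have [|x|e he Ee] := @cf_search (jump A) (fun x e => prog_index e == (c x).+1).
- have h : cfun (jump A) (fun z => c (p1 z)) by apply: (cf_comp hc); cf.
  cf.
- exists (pickle (prog_to_tree (PComp (PMu q) (K x)))).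
  by rewrite prog_indexE /decode_prog pickleK /= -/(prog_to_tree _) !prog_treeK.
apply: (turing_le_reduce he) => x; rewrite hqS jumpE (eqP (Ee x)) /=.
split=> [[y h]|[s]].
  have /stage_spec[s E] : eval A (PComp (PMu q) (K x)) (e x) y by apply: eComp (KE _ _) h.
  by exists s; rewrite E.
case E: (stage _ _ _ _) => [|y] // _; exists y.
have := stage_sound E => h; inversion h; subst.
match goal with H : eval A (K x) _ ?u |- _ => by rewrite (eval_det (KE _ _) H) end.
Qed.

Lemma turing_le_jump A : turing_le A (jump A).
Proof.
apply: sigma1_le_jump; exists (fun x _ => ind A x); first by cf.
by move=> x; split=> [h|[_ /indP//]]; exists 0; apply/indP.
Qed.

Lemma sigma1_mono A B S : turing_le A B -> sigma1 A S -> sigma1 B S.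
Proof. by move=> hAB [b hb hS]; exists b => //; apply: cfun_trans hb. Qed.

Lemma jump_mono A B : turing_le A B -> turing_le (jump A) (jump B).
Proof. by move=> hAB; apply/sigma1_le_jump/(sigma1_mono hAB)/sigma1_jump. Qed.

(* The least [i < n] in [P] if there is one, and [n] otherwise. *)
Definition bmin (P : pred nat) (n : nat) : nat :=
  nat_rec (fun=> nat) 0 (fun i r => if P r then r else i.+1) n.

Lemma bminP (P : pred nat) n i : i <= n -> P i -> P (bmin P n) /\ forall j, P j -> bmin P n <= j.
Proof.
move=> le hi; have [h1 h2] : (forall j, P j -> bmin P n <= j) /\ (P (bmin P n) \/ bmin P n = n).
  elim: n {le} => [|n [IH1 IH2]] /=; first by split; [|right].
  case: ifP => h; first by split; [|left].
  split; last by right.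
  move=> j hj; case: IH2 => [|E]; first by rewrite h.
  have := IH1 _ hj; rewrite E leq_eqVlt => /orP[/eqP Ej|//].
  by rewrite E Ej hj in h.
split=> //; case: h2 => // E; have := h1 _ hi; rewrite E => le'.
by have -> : n = i by lia.
Qed.

Lemma cf_bmin A (b : nat -> nat -> bool) n : cfun A (fun z => b (p1 z) (p2 z)) -> cfun A n ->
  cfun A (fun x => bmin (b x) (n x)).
Proof.
move=> hb hn; apply: (@cf_rec _ (fun x i r => if b x r then r else i.+1)); [|cf|cf].
have h : cfun A (fun z => b (p1 (p1 z)) (p2 z)).
  by apply: (cf2 (F := fun x y => nat_of_bool (b x y)) hb); cf.
cf.
Qed.

(* Structural total version of evaluation: the oracle is replaced by its stage-[s] approximation and
   searches are cut off at [s]. *)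
Section Approximation.
Variables (B : set_nat) (o : nat -> nat -> bool).

Fixpoint approx (p : prog) (s x : nat) : nat :=
  match p with
  | PZero => 0
  | PSucc => x.+1
  | PId => x
  | PFst => p1 x
  | PSnd => p2 x
  | POrac => o s x
  | PComp f g => approx f s (approx g s x)
  | PPair f g => cpair (approx f s x) (approx g s x)
  | PRec f g => nat_rec (fun=> nat) (approx f s (p1 x))
      (fun n y => approx g s (cpair (cpair (p1 x) n) y)) (p2 x)
  | PMu f => bmin (fun n => approx f s (cpair x n) == 0) s
  end.

Lemma cf_approx p : cfun B (fun z => o (p1 z) (p2 z)) -> cfun B (fun z => approx p (p1 z) (p2 z)).
Proof.
move=> ho; elim: p => /= [|||||| f IHf g IHg | f IHf g IHg | f IHf g IHg | f IHf]; try by cf.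
- by apply: (cf2 (F := approx f) IHf); cf.
- apply: (@cf_rec _ (fun z n y => approx g (p1 z) (cpair (cpair (p1 (p2 z)) n) y))); last by cf.
    by apply: (cf2 (F := approx g) IHg); cf.
  by apply: (cf2 (F := approx f) IHf); cf.
- apply: (@cf_bmin _ (fun z n => approx f (p1 z) (cpair (p2 z) n) == 0)); last by cf.
  have h : cfun B (fun z => approx f (p1 (p1 z)) (cpair (p2 (p1 z)) (p2 z))).
    by apply: (cf2 (F := approx f) IHf); cf.
  cf.
Qed.

Lemma approx_lim A p x y : (forall x, exists N, forall s, N <= s -> o s x = ind A x) ->
  eval A p x y -> exists N, forall s, N <= s -> approx p s x = y.
Proof.
move=> ho; move: p x y; apply: eval_ind_strong => /=; try by exists 0.
- by move=> a b; exists 0 => *; rewrite p1K.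
- by move=> a b; exists 0 => *; rewrite p2K.
- by move=> x; have [N h] := ho x; exists N => s /h ->.
- move=> f g x y z _ [N1 h1] _ [N2 h2]; exists (maxn N1 N2) => s; rewrite geq_max => /andP[le1 le2].
  by rewrite h1 // h2.
- move=> f g x y z _ [N1 h1] _ [N2 h2]; exists (maxn N1 N2) => s; rewrite geq_max => /andP[le1 le2].
  by rewrite h1 // h2.
- by move=> f g x y _ [N h]; exists N => s /h; rewrite p1K p2K.
- move=> f g x n y z _ [N1 h1] _ [N2 h2]; exists (maxn N1 N2) => s; rewrite geq_max => /andP[le1 le2].
  by have := h1 _ le1; rewrite !(p1K, p2K) /= => ->; apply: h2.
- move=> f x n _ [N h] hm.
  have [M hM] : exists M, forall s m, M <= s -> m < n -> approx f s (cpair x m) != 0.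
    elim: n hm {h} => [|n IH] hm; first by exists 0.
    have [M hM] := IH (fun m lt => hm m (ltnW lt)).
    have [k k0 [_ [M' hM']]] := hm n (ltnSn n).
    exists (maxn M M') => s m; rewrite geq_max ltnS => /andP[le1 le2].
    rewrite leq_eqVlt => /orP[/eqP->|]; last exact: hM.
    by rewrite hM' //; apply/eqP.
  (* Besides the settling times, [s] must reach [n], so that the search cut off at [s] does not miss
     the zero there. *)
  exists (maxn n (maxn N M)) => s; rewrite !geq_max => /and3P[le1 le2 le3].
  have [|h1 h2] := @bminP (fun m => approx f s (cpair x m) == 0) s n le1; first by rewrite h.
  apply/eqP; rewrite eqn_leq h2 ?h //= leqNgt; apply/negP => lt.
  by have := hM _ _ le3 lt; rewrite h1.
Qed.
End Approximation.

Lemma limit_lemma B f : cfun (jump B) f -> exists2 h : nat -> nat -> nat,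
  cfun B (fun z => h (p1 z) (p2 z)) & forall x, exists N, forall s, N <= s -> h x s = f x.
Proof.
move=> [p hp]; have [b hb hJ] := sigma1_jump B.
(* True exactly when some witness is at most [s], so it changes at most once as [s] grows. *)
pose o s x := b x (bmin (b x) s).
have ho : cfun B (fun z => o (p1 z) (p2 z)).
  apply: (cf2 (F := fun x y => nat_of_bool (b x y)) hb); first by cf.
  apply: (@cf_bmin _ (fun z => b (p2 z))); last by cf.
  by apply: (cf2 (F := fun x y => nat_of_bool (b x y)) hb); cf.
exists (fun x s => approx o p s x).
  by apply: (cf2 (F := approx o p) (cf_approx p ho)); cf.
move=> x; apply: approx_lim (hp x) => {}x.
case: (indP (jump B) x) => [/hJ[n hn]|h].
  by exists n => s le; case: (bminP le hn).
by exists 0 => s _; apply/negP => hs; apply: h; apply/hJ; eexists; apply: hs.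
Qed.

(** * The generic coloring *)

(** Applied with [V] the jump of the join of [S] and [zero_jump n], and [B] the jump of
    [zero_jump n]; the third hypothesis is then lowness. *)
Lemma generic_coloring S B V :
  turing_le (jump S) V -> turing_le B V -> turing_le (jump V) (jump B) ->
  exists2 f, cfun B f &
  forall p v, infinite (fun x => eval S p x 1) -> exists2 x, eval S p x 1 & f x = v.
Proof.
move=> leJV leBV low2.
have leSV : turing_le S V := turing_le_trans (turing_le_jump S) leJV.
(* The set of [c] has an element at or above the given bound; [n] codes the element and a halting
   time. As [stage] adds one to outputs, [2] stands for output [1]. *)
pose tail : set_nat := fun z => exists n, (p2 z <= p1 n) && (stage S (p1 z) (p1 n) (p2 n) == 2).
have ltail : turing_le tail V.
  apply: turing_le_trans leJV; apply: sigma1_le_jump.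
  by exists (fun z n => (p2 z <= p1 n) && (stage S (p1 z) (p1 n) (p2 n) == 2)) => //; cf.
(* A witness gives either a bound from which on the set of [c] is empty, or an element of it with
   two halting times. Program [j] receives its own code along with the element. *)
pose q z n := let j := p1 z in let c := p1 (p2 z) in let v := p2 (p2 z) in
  ~~ ind tail (cpair c (p1 n)) ||
  (stage S c (p1 n) (p1 (p2 n)) == 2) && (stage B j (cpair j (p1 n)) (p2 (p2 n)) == v.+1).
pose Q : set_nat := fun z => exists n, q z n.
(* [tail], [S] and [B] are decidable in [V], so [Q] is Sigma_1 in [V], and [low2] brings it down to
   [jump B]. *)
have lQ : turing_le Q (jump B).
  apply: turing_le_trans low2; apply: sigma1_le_jump; exists q => //.
  have h1 : cfun V (fun z => ind tail (cpair (p1 (p2 (p1 z))) (p1 (p2 z)))).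
    by apply: (cfun_trans ltail); cf.
  have h2 : cfun V (fun z => stage S (p1 (p2 (p1 z))) (p1 (p2 z)) (p1 (p2 (p2 z)))).
    by apply: (cfun_trans leSV); cf.
  have h3 : cfun V (fun z =>
      stage B (p1 (p1 z)) (cpair (p1 (p1 z)) (p1 (p2 z))) (p2 (p2 (p2 z)))).
    by apply: (cfun_trans leBV); cf.
  by rewrite /q; cf.
have /turing_leE/limit_lemma[k hk klim] := lQ.
(* Value [0] of [k] means that the requirement looks unmet. Since the index is an argument of [F],
   feeding [F] its own code replaces the recursion theorem. When nothing below [s] looks unmet,
   [bmin] returns the harmless default [s]. *)
pose F j s := p2 (bmin (fun i => k (cpair j i) s == 0) s).
have [pF hF] : cfun B (fun z => F (p1 z) (p2 z)).
  apply/cf_p2/(@cf_bmin _ (fun z i => k (cpair (p1 z) i) (p2 z) == 0)); last by cf.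
  have h : cfun B (fun z => k (cpair (p1 (p1 z)) (p2 z)) (p2 (p1 z))).
    by apply: (cf2 hk); cf.
  cf.
pose j := pc pF.
(* [j] is a program for [F] itself, so [Q (cpair j (cpair c v))] says that [F j] meets the
   requirement for the set enumerated by [c] and the color [v]. *)
have allQ i : Q (cpair j i).
  elim/ltn_ind: i => i IH; apply: NNPP => nQ.
  have [M1 h1] : exists M, forall s i', M <= s -> i' < i -> k (cpair j i') s = 1.
    elim: i IH {nQ} => [|i IHi] IH; first by exists 0.
    have [M hM] := IHi (fun i' lt => IH i' (ltnW lt)).
    have [M' hM'] := klim (cpair j i).
    exists (maxn M M') => s i'; rewrite geq_max ltnS => /andP[le1 le2].
    rewrite leq_eqVlt => /orP[/eqP->|]; last exact: hM.
    by rewrite hM' //; case: indP => // /(_ (IH i (ltnSn i))).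
  have [M2 h2] := klim (cpair j i).
  pose M := maxn i (maxn M1 M2).
  (* From [M] on, all requirements before [i] look met and [i] looks unmet, which fixes the color.
     An element of the set beyond [M] then meets [i]; if there is none, the first disjunct of [q]
     holds. *)
  have hf s : M <= s -> F j s = p2 i.
    rewrite !geq_max => /and3P[le0 le1 le2]; rewrite /F.
    have [|e1 e2] := @bminP (fun i => k (cpair j i) s == 0) s i le0.
      by rewrite h2 //; case: indP.
    congr p2; apply/eqP; rewrite eqn_leq e2 ?h2 //=; last by case: indP.
    by rewrite leqNgt; apply/negP => lt; rewrite h1 in e1.
  apply: nQ; case: (indP tail (cpair (p1 i) M)) => ht; last first.
    by exists (cpair M 0); rewrite /q !(p1K, p2K); case: indP.
  have [n] := ht; rewrite !(p1K, p2K) => /andP[/hf fE sE].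
  have /stage_spec[s Es] := hF (cpair j (p1 n)); rewrite !(p1K, p2K) fE in Es.
  exists (cpair (p1 n) (cpair (p2 n) s)).
  by rewrite /q !(p1K, p2K) sE /= Es eqxx orbT.
exists (F j) => [|p v inf].
  by have := @cf2 B F (fun=> j) id (ex_intro _ pF hF); apply; cf.
have [n] := allQ (cpair (pc p) v); rewrite /q !(p1K, p2K) => /orP[/negP|/andP[/eqP e1 /eqP e2]].
  case; apply/indP; have [x le /stage_spec[s Es]] := inf (p1 n).
  by exists (cpair x s); rewrite !(p1K, p2K) le Es.
exists (p1 n); first exact: stage_sound e1.
have := eval_det (hF _) (stage_sound e2); rewrite !(p1K, p2K) => <-.
by [].
Qed.

(** * Iterated limits and colorings of tuples *)

(** Each use of the limit lemma removes one jump and appends one limit variable, as the second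
    component of a new outer pair. *)
Lemma iterated_limit n f : cfun (zero_jump n) f -> exists h : nat -> nat -> nat,
  [/\ h 0 = f, cfun empty_set (h n) & forall m x, m < n ->
      exists N, forall s, N <= s -> h m.+1 (cpair x s) = h m x].
Proof.
elim: n f => [|n IH] f hf; first by exists (fun=> f).
have [f1 /IH[h [h0 hn hl]] lim] := limit_lemma hf.
exists (fun m => if m is m'.+1 then h m' else f); split=> // -[|m] x lt; last exact: hl.
by have [N hN] := lim x; exists N => s /hN; rewrite h0 p1K p2K.
Qed.

(* [tup [:: x; s1; ...; sm]] is [cpair (... (cpair x s1) ...) sm]. *)
Definition tup (s : seq nat) : nat := foldl cpair (head 0 s) (behead s).

Lemma tup_rcons s x : s != [::] -> tup (rcons s x) = cpair (tup s) x.
Proof. by case: s => //= a s _; rewrite /tup /= foldl_rcons. Qed.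

Lemma code_seq_inj : injective code_seq.
Proof. by elim=> [|x s IH] [|y t] //= [/cpair_inj[-> /IH->]]. Qed.

(* [c] codes a strictly increasing sequence of length [k] with entries at least [b]. *)
Fixpoint increasing_code (k b c : nat) : bool :=
  if k is k'.+1 then [&& c != 0, b <= lhd c & increasing_code k' (lhd c).+1 (ltl c)] else c == 0.

Lemma increasing_codeP k b c : increasing_code k b c <->
  exists2 s, c = code_seq s & [&& size s == k, b <= head b s & sorted ltn s].
Proof.
elim: k b c => [|k IH] b c /=.
  by split=> [/eqP->|[[|x s] -> //]]; exists [::] => //=; rewrite leqnn.
split=> [/and3P[c0 le /IH[s E /and3P[/eqP Es hs ss]]]|[[|x s] -> //= /and3P[Es le ps]]].
  exists (lhd c :: s) => /=; last first.
    by rewrite Es eqxx le /=; case: s hs ss {E Es} => //= y s ->.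
  by rewrite -E /lhd /ltl cpairK prednK // lt0n.
rewrite /lhd /ltl /= p1K p2K le /=; apply/IH; exists s => //.
by move: Es; rewrite eqSS => ->; case: s ps => //= *; rewrite ltnSn.
Qed.

Lemma cf_increasing_code A k : cfun A (fun z => increasing_code k (p1 z) (p2 z)).
Proof.
elim: k => [|k IH] /=; first by cf.
have h : cfun A (fun z => increasing_code k (lhd (p2 z)).+1 (ltl (p2 z))).
  by apply: (cf2 (F := fun b c => nat_of_bool (increasing_code k b c)) IH); cf.
cf.
Qed.

Lemma codes_fn_computable k h : cfun empty_set h -> exists2 X, computable X &
  codes_fn k.+1 (fun s => h (tup s)) X.
Proof.
move=> hh; pose t c := lfold cpair (lhd c) (ltl c).
have tE s : s != [::] -> t (code_seq s) = tup s.
  by case: s => //= x s _; rewrite /t -/(lcons _ _) lhdK ltlK lfoldE.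
exists (fun m => increasing_code k.+1 0 (p1 m) && (p2 m == h (t (p1 m)))).
  have h1 : cfun empty_set (fun m => h (t (p1 m))).
    by apply: (cf_comp hh); apply: cf_lfold; cf.
  have h2 : cfun empty_set (fun m => increasing_code k.+1 0 (p1 m)).
    by apply: (cf2 (F := fun b c => nat_of_bool (increasing_code k.+1 b c))
      (cf_increasing_code _ _)); cf.
  apply/turing_leE; have : cfun empty_set
    (fun m => increasing_code k.+1 0 (p1 m) && (p2 m == h (t (p1 m)))) by cf.
  by apply: eq_cfun => m; congr nat_of_bool; apply/idP/indP.
move=> m; split=> [/andP[/increasing_codeP[s Es /and3P[sk _ ss]] /eqP Em]|[s /andP[sk ss] ->]].
  exists s; first by rewrite /finsub sk.
  by rewrite -tE -?Es -?Em ?cpairK //; case: s sk {Es ss}.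
rewrite p1K p2K tE ?eqxx ?andbT; last by case: s sk {ss}.
by apply/increasing_codeP; exists s => //; rewrite sk ss andbT.
Qed.

Lemma finsub_rcons k s x : finsub k s -> last 0 s < x -> finsub k.+1 (rcons s x).
Proof.
case/andP=> /eqP <- ss lt; rewrite /finsub size_rcons eqxx /=.
by case: s ss lt => //= a s; rewrite rcons_path => ->.
Qed.

(** Start from the singleton [a] and keep appending elements of [A] that exceed the last entry and
    lie where the next limit has settled; the color [v] is preserved. *)
Lemma iterated_limit_attained n (h : nat -> nat -> nat) A v a : 
  (forall m x, m < n -> exists N, forall s, N <= s -> h m.+1 (cpair x s) = h m x) ->
  infinite A -> A a -> h 0 a = v -> exists2 s, finsub_of A n.+1 s & h n (tup s) = v.
Proof.
move=> lim inf Aa ha.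
suff H m : m <= n -> exists2 s, finsub_of A m.+1 s & h m (tup s) = v by apply: H.
elim: m => [|m IH] lt.
  exists [:: a] => //; split=> // x; by rewrite inE => /eqP->.
have [s [fs sA] hs] := IH (ltnW lt).
have [N hN] := lim m (tup s) lt.
have [x le Ax] := inf (maxn N (last 0 s).+1).
move: le; rewrite geq_max => /andP[le1 le2].
exists (rcons s x); last by rewrite tup_rcons ?hN //; case: s fs {sA hs hN le2}.
split; first exact: finsub_rcons.
by move=> y; rewrite mem_rcons inE => /orP[/eqP->|/sA].
Qed.

Theorem theorem4p9 :
  forall (n : nat) (P : principle),
    (exists M, omega_model P M /\ forall X, M X -> low2_over X (zero_jump n)) ->
    c_reducible (STS n.+2) P ->
    ~ has_universal_instance P.
Proof.
move=> n P [M [[[X0 MX0] Mjoin Mle Msol] Mlow]] red [U [compU instU univ]].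
(* A nonempty class closed downward contains every computable set, in particular [U]. *)
have [S MS solS] : exists2 S, M S & sol P U S.
  by apply: Msol instU; apply: Mle MX0 _; apply: computable_le.
have [f hf meets] := generic_coloring (jump_mono (join_lel S (zero_jump n)))
  (jump_mono (join_ler S (zero_jump n))) (Mlow _ MS).
have [h [h0 hn lim]] := @iterated_limit n.+1 f hf.
have [X compX codeX] := codes_fn_computable n.+1 hn.
have instX : inst (STS n.+2) X.
  (* Stability is the clause of [lim] for the last variable. *)
  exists (fun s => h n.+1 (tup s)); split=> // sigma fs.
  have [N hN] := lim n (tup sigma) (ltnSn n).
  exists (h n (tup sigma)), N => s le _; rewrite tup_rcons ?hN //.
  by case: sigma fs {hN}.
have [Y [leYX instY] back] := red X instX.
have [T solT leT] := univ S solS Y (turing_le_trans leYX compX) instY.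
have [A [g [codeg infA [v thinv]]] leA] := back T solT.
have [p hp] : turing_le A S.
  by apply: turing_le_trans leA _; apply: join_lub leT _; apply: computable_le.
have evalA x : eval S p x 1 -> A x.
  move=> e; apply: NNPP => nA; have [_ /(_ nA) e0] := hp x.
  by have := eval_det e e0.
have [|a /evalA Aa fa] := meets p v.
  by move=> N; have [x le Ax] := infA N; exists x => //; have [/(_ Ax)] := hp x.
have [s fs hs] : exists2 s, finsub_of A n.+2 s & h n.+1 (tup s) = v.
  by apply: iterated_limit_attained lim infA Aa _; rewrite h0.
(* Thinness concerns the function [g] supplied with the solution; it is compared with [h n.+1]
   through their common code [X]. *)
apply: (thinv s fs).
have /codeg[t _ /cpair_inj[/code_seq_inj <- <-]] : X (cpair (code_seq s) (h n.+1 (tup s))).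
  by apply/codeX; exists s => //; case: fs.
exact: hs.
Qed.
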